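(* Let $M$ be an invertible form. (1) If $N$ is an invertible form, then $M\{N/x\}$ is an invertible form and $\lfloor M\rfloor\{\lfloor N\rfloor/x\}=\lfloor M\{N/x\}\rfloor$. (2) If $M\hookrightarrow N$ by one step of the rule $\mathbf{app}_{s_1,s_2}AB(\mathbf{abs}_{s_1,s_2}A'B'P)Q\hookrightarrow PQ$, then $N$ is an invertible form and $\lfloor M\rfloor\hookrightarrow^*\lfloor N\rfloor$ in the EPTS. (3) If $M\hookrightarrow N$ by one step of Dedukti $\beta$ or of a rule $\mathbf{El}_{s_2}\mathbf u_{s_1}\hookrightarrow\mathbf U_{s_1}$, then $N$ is an invertible form and $\lfloor M\rfloor=\lfloor N\rfloor$. (4) If $M\hookrightarrow^*_{\beta\mathscr R_{EPTS}}N$, then $N$ is an invertible form and $\lfloor M\rfloor\hookrightarrow^*\lfloor N\rfloor$ in the EPTS.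
   Context: Functional PTS specification $(\mathcal S,\mathcal A,\mathcal R)$; EPTS terms $x\mid s\mid\Pi_{s_1,s_2}(A,x.B)\mid\lambda_{s_1,s_2}(A,x.B,x.M)\mid@_{s_1,s_2}(A,x.B,M,N)$ with EPTS reduction the context closure of $@_{s_1,s_2}(A,x.B,\lambda_{s_1,s_2}(A',x.B',x.M),N)\hookrightarrow M\{N/x\}$. Dedukti rewrite system $\mathscr R_{EPTS}$: rules $\mathbf{El}_{s_2}\mathbf u_{s_1}\hookrightarrow\mathbf U_{s_1}$ for $(s_1,s_2)\in\mathcal A$ and $\mathbf{app}_{s_1,s_2}AB(\mathbf{abs}_{s_1,s_2}A'B'M)N\hookrightarrow MN$ for $(s_1,s_2,s_3)\in\mathcal R$, closed under contexts and substitutions; $\hookrightarrow_{\beta\mathscr R_{EPTS}}$ adds Dedukti $\beta$. Invertible forms: Dedukti terms generated by $M,N,A,B::=x\mid\mathbf u_s\mid\mathbf{abs}_{s_1,s_2}A(\lambda x:T_1.B)(\lambda x:T_2.M)\mid(\lambda x:T.M)N\mid\mathbf{Prod}_{s_1,s_2}A(\lambda x:T_1.B)\mid\mathbf{app}_{s_1,s_2}A(\lambda x:T_1.B)MN$ with $T,T_1,T_2$ arbitrary. Inverse translation: $\lfloor x\rfloor=x$, $\lfloor\mathbf u_s\rfloor=s$, $\lfloor(\lambda x:T.M)N\rfloor=\lfloor M\rfloor\{\lfloor N\rfloor/x\}$, $\lfloor\mathbf{Prod}_{s_1,s_2}A(\lambda x:T.B)\rfloor=\Pi_{s_1,s_2}(\lfloor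 A\rfloor,x.\lfloor B\rfloor)$, $\lfloor\mathbf{abs}_{s_1,s_2}A(\lambda x:T.B)(\lambda x:T'.M)\rfloor=\lambda_{s_1,s_2}(\lfloor A\rfloor,x.\lfloor B\rfloor,x.\lfloor M\rfloor)$, $\lfloor\mathbf{app}_{s_1,s_2}A(\lambda x:T.B)MN\rfloor=@_{s_1,s_2}(\lfloor A\rfloor,x.\lfloor B\rfloor,\lfloor M\rfloor,\lfloor N\rfloor)$. *)

(* Defs.v *)
From Stdlib Require Import Arith Relations.

Set Implicit Arguments.

Record pts_spec : Type := PtsSpec {
  sort :> Type;
  ax : sort -> sort -> Prop;
  rule : sort -> sort -> sort -> Prop
}.

Definition functional (P : pts_spec) : Prop :=
  (forall s1 s2 s2' : P, ax P s1 s2 -> ax P s1 s2' -> s2 = s2') /\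
  (forall s1 s2 s3 s3' : P, rule P s1 s2 s3 -> rule P s1 s2 s3' -> s3 = s3').

(* Terms up to alpha-equivalence, as de Bruijn terms: [x.B] is a body in which
   index 0 is x and the indices of the surrounding scope are shifted by one. *)

Definition up_ren (r : nat -> nat) (n : nat) : nat :=
  match n with 0 => 0 | S n => S (r n) end.

Inductive epts (Srt : Type) : Type :=
| EVar : nat -> epts Srt
| ESort : Srt -> epts Srt
| EPi (s1 s2 : Srt) (A B : epts Srt)       (* B under x *)
| ELam (s1 s2 : Srt) (A B M : epts Srt)    (* B and M each under x *)
| EApp (s1 s2 : Srt) (A B M N : epts Srt). (* B under x *)

Arguments EVar {Srt} _.

Fixpoint eren (Srt : Type) (r : nat -> nat) (M : epts Srt) : epts Srt :=
  match M with
  | EVar n => EVar (r n)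
  | ESort s => ESort s
  | EPi s1 s2 A B => EPi s1 s2 (eren r A) (eren (up_ren r) B)
  | ELam s1 s2 A B M =>
      ELam s1 s2 (eren r A) (eren (up_ren r) B) (eren (up_ren r) M)
  | EApp s1 s2 A B M N =>
      EApp s1 s2 (eren r A) (eren (up_ren r) B) (eren r M) (eren r N)
  end.

Definition eup (Srt : Type) (f : nat -> epts Srt) (n : nat) : epts Srt :=
  match n with 0 => EVar 0 | S n => eren S (f n) end.

Fixpoint esubst (Srt : Type) (f : nat -> epts Srt) (M : epts Srt) : epts Srt :=
  match M with
  | EVar n => f n
  | ESort s => ESort s
  | EPi s1 s2 A B => EPi s1 s2 (esubst f A) (esubst (eup f) B)
  | ELam s1 s2 A B M =>
      ELam s1 s2 (esubst f A) (esubst (eup f) B) (esubst (eup f) M)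
  | EApp s1 s2 A B M N =>
      EApp s1 s2 (esubst f A) (esubst (eup f) B) (esubst f M) (esubst f N)
  end.

(* M{N/x} for a free variable x; all other variables keep their index. *)
Definition esubst_var (Srt : Type) (x : nat) (N M : epts Srt) : epts Srt :=
  esubst (fun y => if y =? x then N else EVar y) M.

(* M{N/x} for a body x.M: the binder of index 0 disappears. *)
Definition einst (Srt : Type) (N M : epts Srt) : epts Srt :=
  esubst (fun y => match y with 0 => N | S y => EVar y end) M.

Inductive estep (Srt : Type) : epts Srt -> epts Srt -> Prop :=
| estep_beta s1 s2 A B A' B' M N :
    estep (EApp s1 s2 A B (ELam s1 s2 A' B' M) N) (einst N M)
| estep_Pi1 s1 s2 A A' B :
    estep A A' -> estep (EPi s1 s2 A B) (EPi s1 s2 A' B)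
| estep_Pi2 s1 s2 A B B' :
    estep B B' -> estep (EPi s1 s2 A B) (EPi s1 s2 A B')
| estep_Lam1 s1 s2 A A' B M :
    estep A A' -> estep (ELam s1 s2 A B M) (ELam s1 s2 A' B M)
| estep_Lam2 s1 s2 A B B' M :
    estep B B' -> estep (ELam s1 s2 A B M) (ELam s1 s2 A B' M)
| estep_Lam3 s1 s2 A B M M' :
    estep M M' -> estep (ELam s1 s2 A B M) (ELam s1 s2 A B M')
| estep_App1 s1 s2 A A' B M N :
    estep A A' -> estep (EApp s1 s2 A B M N) (EApp s1 s2 A' B M N)
| estep_App2 s1 s2 A B B' M N :
    estep B B' -> estep (EApp s1 s2 A B M N) (EApp s1 s2 A B' M N)
| estep_App3 s1 s2 A B M M' N :
    estep M M' -> estep (EApp s1 s2 A B M N) (EApp s1 s2 A B M' N)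
| estep_App4 s1 s2 A B M N N' :
    estep N N' -> estep (EApp s1 s2 A B M N) (EApp s1 s2 A B M N').

Definition esteps (Srt : Type) : relation (epts Srt) :=
  clos_refl_trans (epts Srt) (@estep Srt).

(* Constants are indexed by arbitrary sorts; the side conditions on the PTS
   specification are carried by the rewrite rules. *)
Inductive dk_const (Srt : Type) : Type :=
| cU (s : Srt)
| cEl (s : Srt)
| cu (s : Srt)
| cProd (s1 s2 : Srt)
| cabs (s1 s2 : Srt)
| capp (s1 s2 : Srt).

Inductive dk (Srt : Type) : Type :=
| Var : nat -> dk Srt
| Const : dk_const Srt -> dk Srt
| TYPE : dk Srt
| KIND : dk Srt
| App (M N : dk Srt)
| Lam (T M : dk Srt)  (* lambda x : T. M, with M under x *)
| Pi (T M : dk Srt).  (* Pi x : T. M, with M under x *)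

Arguments Var {Srt} _.
Arguments TYPE {Srt}.
Arguments KIND {Srt}.

Fixpoint dren (Srt : Type) (r : nat -> nat) (M : dk Srt) : dk Srt :=
  match M with
  | Var n => Var (r n)
  | Const c => Const c
  | TYPE => TYPE
  | KIND => KIND
  | App M N => App (dren r M) (dren r N)
  | Lam T M => Lam (dren r T) (dren (up_ren r) M)
  | Pi T M => Pi (dren r T) (dren (up_ren r) M)
  end.

Definition dup (Srt : Type) (f : nat -> dk Srt) (n : nat) : dk Srt :=
  match n with 0 => Var 0 | S n => dren S (f n) end.

Fixpoint dsubst (Srt : Type) (f : nat -> dk Srt) (M : dk Srt) : dk Srt :=
  match M with
  | Var n => f n
  | Const c => Const c
  | TYPE => TYPE
  | KIND => KIND
  | App M N => App (dsubst f M) (dsubst f N)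
  | Lam T M => Lam (dsubst f T) (dsubst (dup f) M)
  | Pi T M => Pi (dsubst f T) (dsubst (dup f) M)
  end.

Definition dsubst_var (Srt : Type) (x : nat) (N M : dk Srt) : dk Srt :=
  dsubst (fun y => if y =? x then N else Var y) M.

Definition dinst (Srt : Type) (N M : dk Srt) : dk Srt :=
  dsubst (fun y => match y with 0 => N | S y => Var y end) M.

Definition dProd (Srt : Type) (s1 s2 : Srt) (A B : dk Srt) : dk Srt :=
  App (App (Const (cProd s1 s2)) A) B.

Definition dabs (Srt : Type) (s1 s2 : Srt) (A B M : dk Srt) : dk Srt :=
  App (App (App (Const (cabs s1 s2)) A) B) M.

Definition dapp (Srt : Type) (s1 s2 : Srt) (A B M N : dk Srt) : dk Srt :=
  App (App (App (App (Const (capp s1 s2)) A) B) M) N.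

(* Head steps. The metavariables of the rules range over all terms, which gives
   the closure under substitutions. *)

Inductive beta (Srt : Type) : relation (dk Srt) :=
| beta_red T M N : beta (App (Lam T M) N) (dinst N M).

Inductive rule_El (P : pts_spec) : relation (dk P) :=
| rule_El_red s1 s2 :
    ax P s1 s2 -> rule_El P (App (Const (cEl s2)) (Const (cu s1))) (Const (cU s1)).

Inductive rule_app (P : pts_spec) : relation (dk P) :=
| rule_app_red s1 s2 s3 A B A' B' M N :
    rule P s1 s2 s3 ->
    rule_app P (dapp s1 s2 A B (dabs s1 s2 A' B' M) N) (App M N).

Inductive ctx (Srt : Type) (R : relation (dk Srt)) : relation (dk Srt) :=
| ctx_head M N : R M N -> ctx R M N
| ctx_App1 M M' N : ctx R M M' -> ctx R (App M N) (App M' N)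
| ctx_App2 M N N' : ctx R N N' -> ctx R (App M N) (App M N')
| ctx_Lam1 T T' M : ctx R T T' -> ctx R (Lam T M) (Lam T' M)
| ctx_Lam2 T M M' : ctx R M M' -> ctx R (Lam T M) (Lam T M')
| ctx_Pi1 T T' M : ctx R T T' -> ctx R (Pi T M) (Pi T' M)
| ctx_Pi2 T M M' : ctx R M M' -> ctx R (Pi T M) (Pi T M').

Definition dk_R_EPTS (P : pts_spec) : relation (dk P) :=
  fun M N => rule_El P M N \/ rule_app P M N.

Definition dk_beta_R_EPTS (P : pts_spec) : relation (dk P) :=
  fun M N => beta M N \/ dk_R_EPTS P M N.

Inductive invertible (Srt : Type) : dk Srt -> Prop :=
| inv_Var x : invertible (Var x)
| inv_u s : invertible (Const (cu s))
| inv_abs s1 s2 A T1 B T2 M :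
    invertible A -> invertible B -> invertible M ->
    invertible (dabs s1 s2 A (Lam T1 B) (Lam T2 M))
| inv_beta T M N :
    invertible M -> invertible N -> invertible (App (Lam T M) N)
| inv_Prod s1 s2 A T1 B :
    invertible A -> invertible B -> invertible (dProd s1 s2 A (Lam T1 B))
| inv_app s1 s2 A T1 B M N :
    invertible A -> invertible B -> invertible M -> invertible N ->
    invertible (dapp s1 s2 A (Lam T1 B) M N).

(* Meaningful on invertible forms only: the last branch is a dummy value. *)
Fixpoint inverse (Srt : Type) (M : dk Srt) : epts Srt :=
  match M with
  | Var x => EVar x
  | Const (cu s) => ESort s
  | App (Lam _ M) N => einst (inverse N) (inverse M)
  | App (App (Const (cProd s1 s2)) A) (Lam _ B) =>
      EPi s1 s2 (inverse A) (inverse B)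
  | App (App (App (Const (cabs s1 s2)) A) (Lam _ B)) (Lam _ M) =>
      ELam s1 s2 (inverse A) (inverse B) (inverse M)
  | App (App (App (App (Const (capp s1 s2)) A) (Lam _ B)) M) N =>
      EApp s1 s2 (inverse A) (inverse B) (inverse M) (inverse N)
  | _ => EVar 0
  end.

(* Main.v *)
Require Import Defs.
From Stdlib Require Import Arith Relations.

(** Inverse translation commutes with every substitution by invertible forms, so
    both sides of a [beta] step have the same inverse translation, and an [app]
    step at the root is sent to one EPTS beta step. A rewrite step below the root of an
    invertible form takes place either in an ignored type annotation or in an
    invertible subterm, hence it suffices that the target relation (equality for
    [beta] and [El], EPTS reduction for [app]) be compatible with the term
    constructors and with substitution. No instance of [El] has an invertible
    left-hand side. *)

Set Implicit Arguments.

(** * Substitution calculus of EPTS terms *)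

Section EptsSubstitution.

Variable Srt : Type.

Implicit Types M N : epts Srt.

(** Takes the place of functional extensionality: the lifting of a composite and the composite of
    the liftings agree only pointwise. *)
Lemma esubst_ext M : forall f g : nat -> epts Srt,
  (forall n, f n = g n) -> esubst f M = esubst g M.
Proof.
  induction M; intros f g Hfg; simpl; auto; f_equal; auto;
    match goal with IH : _ |- esubst _ ?t = esubst _ ?t => apply IH end;
    intros [|n]; simpl; rewrite ?Hfg; auto.
Qed.

Lemma eren_esubst M : forall r : nat -> nat,
  eren r M = esubst (fun n => EVar (r n)) M.
Proof.
  assert (Hup : forall (r : nat -> nat) (N : epts Srt),
    esubst (fun n => EVar (up_ren r n)) N
    = esubst (eup (fun n => EVar (r n))) N)
    by (intros; apply esubst_ext; intros [|n]; reflexivity).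
  induction M; intros r; simpl; auto; f_equal; auto;
    match goal with IH : _ |- _ => rewrite IH end; apply Hup.
Qed.

(** The composition laws start with renamings, because each law yields the commutation with the
    shift [S] that the next one needs under a binder. *)
Lemma esubst_eren M : forall (r : nat -> nat) (f : nat -> epts Srt),
  esubst f (eren r M) = esubst (fun n => f (r n)) M.
Proof.
  assert (Hup : forall (r : nat -> nat) f (N : epts Srt),
    esubst (fun n => eup f (up_ren r n)) N
    = esubst (eup (fun n => f (r n))) N)
    by (intros; apply esubst_ext; intros [|n]; reflexivity).
  induction M; intros r f; simpl; auto; f_equal; auto;
    match goal with IH : _ |- _ => rewrite IH end; apply Hup.
Qed.

Lemma eren_up_shift (r : nat -> nat) M :
  eren (up_ren r) (eren S M) = eren S (eren r M).
Proof.
  rewrite (eren_esubst (eren S M)), (eren_esubst (eren r M)), !esubst_eren.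
  reflexivity.
Qed.

Lemma eren_of_esubst M : forall (r : nat -> nat) (f : nat -> epts Srt),
  eren r (esubst f M) = esubst (fun n => eren r (f n)) M.
Proof.
  assert (Hup : forall (r : nat -> nat) f (N : epts Srt),
    esubst (fun n => eren (up_ren r) (eup f n)) N
    = esubst (eup (fun n => eren r (f n))) N)
    by (intros; apply esubst_ext; intros [|n]; simpl;
        rewrite ?eren_up_shift; reflexivity).
  induction M; intros r f; simpl; auto; f_equal; auto;
    match goal with IH : _ |- _ => rewrite IH end; apply Hup.
Qed.

Lemma esubst_up_shift (f : nat -> epts Srt) M :
  esubst (eup f) (eren S M) = eren S (esubst f M).
Proof.
  rewrite esubst_eren, eren_of_esubst; reflexivity.
Qed.

Lemma esubst_esubst M : forall f g : nat -> epts Srt,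
  esubst g (esubst f M) = esubst (fun n => esubst g (f n)) M.
Proof.
  assert (Hup : forall f g (N : epts Srt),
    esubst (fun n => esubst (eup g) (eup f n)) N
    = esubst (eup (fun n => esubst g (f n))) N)
    by (intros; apply esubst_ext; intros [|n]; simpl;
        rewrite ?esubst_up_shift; reflexivity).
  induction M; intros f g; simpl; auto; f_equal; auto;
    match goal with IH : _ |- _ => rewrite IH end; apply Hup.
Qed.

Lemma esubst_id M : esubst EVar M = M.
Proof.
  assert (Hup : forall N : epts Srt, esubst (eup EVar) N = esubst EVar N)
    by (intros; apply esubst_ext; intros [|n]; reflexivity).
  induction M; simpl; rewrite ?Hup; f_equal; auto.
Qed.

(** The classical substitution lemma. At index [S n] the shift introduced by [eup] is cancelled by
    the instantiation. *)
Lemma esubst_einst (f : nat -> epts Srt) N M :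
  esubst f (einst N M) = einst (esubst f N) (esubst (eup f) M).
Proof.
  unfold einst. rewrite !esubst_esubst. apply esubst_ext.
  intros [|n]; simpl; auto.
  rewrite esubst_eren, esubst_id; reflexivity.
Qed.

Lemma eren_einst (r : nat -> nat) N M :
  eren r (einst N M) = einst (eren r N) (eren (up_ren r) M).
Proof.
  rewrite !eren_esubst, esubst_einst. f_equal.
  apply esubst_ext; intros [|n]; reflexivity.
Qed.

End EptsSubstitution.

(** * Compatibility of EPTS reduction with constructors and substitution *)

Section EptsReduction.

Variable Srt : Type.

(** What a target relation must satisfy for a step in a subterm to be carried to the whole form. The
    closure under [einst] answers to Dedukti redexes, which [inverse] contracts; the other closures
    answer to the coded constructors. *)
Record compatible (Q : relation (epts Srt)) : Prop := {
  compatible_refl M : Q M M;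
  compatible_Pi s1 s2 A A' B B' :
    Q A A' -> Q B B' -> Q (EPi s1 s2 A B) (EPi s1 s2 A' B');
  compatible_Lam s1 s2 A A' B B' M M' :
    Q A A' -> Q B B' -> Q M M' ->
    Q (ELam s1 s2 A B M) (ELam s1 s2 A' B' M');
  compatible_App s1 s2 A A' B B' M M' N N' :
    Q A A' -> Q B B' -> Q M M' -> Q N N' ->
    Q (EApp s1 s2 A B M N) (EApp s1 s2 A' B' M' N');
  compatible_einst M M' N N' :
    Q M M' -> Q N N' -> Q (einst N M) (einst N' M')
}.

Lemma compatible_eq : compatible eq.
Proof. split; intros; subst; reflexivity. Qed.

Lemma esteps_map (F : epts Srt -> epts Srt) :
  (forall M N, estep M N -> estep (F M) (F N)) ->
  forall M N, esteps M N -> esteps (F M) (F N).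
Proof.
  intros HF M N H; induction H.
  - apply rt_step; auto.
  - apply rt_refl.
  - eapply rt_trans; eauto.
Qed.

Lemma esteps_Pi s1 s2 (A A' B B' : epts Srt) :
  esteps A A' -> esteps B B' -> esteps (EPi s1 s2 A B) (EPi s1 s2 A' B').
Proof.
  intros HA HB. apply rt_trans with (EPi s1 s2 A' B).
  - apply (esteps_map (fun X => EPi s1 s2 X B)); auto using estep_Pi1.
  - apply (esteps_map (fun X => EPi s1 s2 A' X)); auto using estep_Pi2.
Qed.

Lemma esteps_Lam s1 s2 (A A' B B' M M' : epts Srt) :
  esteps A A' -> esteps B B' -> esteps M M' ->
  esteps (ELam s1 s2 A B M) (ELam s1 s2 A' B' M').
Proof.
  intros HA HB HM. apply rt_trans with (ELam s1 s2 A' B M).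
  - apply (esteps_map (fun X => ELam s1 s2 X B M)); auto using estep_Lam1.
  - apply rt_trans with (ELam s1 s2 A' B' M).
    + apply (esteps_map (fun X => ELam s1 s2 A' X M)); auto using estep_Lam2.
    + apply (esteps_map (fun X => ELam s1 s2 A' B' X)); auto using estep_Lam3.
Qed.

Lemma esteps_App s1 s2 (A A' B B' M M' N N' : epts Srt) :
  esteps A A' -> esteps B B' -> esteps M M' -> esteps N N' ->
  esteps (EApp s1 s2 A B M N) (EApp s1 s2 A' B' M' N').
Proof.
  intros HA HB HM HN. apply rt_trans with (EApp s1 s2 A' B M N).
  - apply (esteps_map (fun X => EApp s1 s2 X B M N)); auto using estep_App1.
  - apply rt_trans with (EApp s1 s2 A' B' M N).
    + apply (esteps_map (fun X => EApp s1 s2 A' X M N)); auto using estep_App2.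
    + apply rt_trans with (EApp s1 s2 A' B' M' N).
      * apply (esteps_map (fun X => EApp s1 s2 A' B' X N));
          auto using estep_App3.
      * apply (esteps_map (fun X => EApp s1 s2 A' B' M' X));
          auto using estep_App4.
Qed.

Lemma estep_esubst (M N : epts Srt) :
  estep M N -> forall f, estep (esubst f M) (esubst f N).
Proof.
  intros H; induction H; intros f; simpl; try (constructor; auto; fail).
  rewrite esubst_einst. constructor.
Qed.

Lemma esteps_esubst (f : nat -> epts Srt) (M N : epts Srt) :
  esteps M N -> esteps (esubst f M) (esubst f N).
Proof. apply esteps_map; auto using estep_esubst. Qed.

Lemma esteps_shift (M N : epts Srt) :
  esteps M N -> esteps (eren S M) (eren S N).
Proof. rewrite !eren_esubst. apply esteps_esubst. Qed.

(** A variable may occur any number of times in [M], so even single steps between [f] and [g] would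
    give a reduction of arbitrary length. *)
Lemma esteps_esubst_pointwise (M : epts Srt) :
  forall f g, (forall n, esteps (f n) (g n)) ->
  esteps (esubst f M) (esubst g M).
Proof.
  assert (Hup : forall f g : nat -> epts Srt,
    (forall n, esteps (f n) (g n)) -> forall n, esteps (eup f n) (eup g n))
    by (intros f g Hfg [|n]; simpl; [apply rt_refl | apply esteps_shift; auto]).
  induction M; intros f g Hfg; simpl; auto using esteps_Pi, esteps_Lam, esteps_App.
  apply rt_refl.
Qed.

Lemma compatible_esteps : compatible (@esteps Srt).
Proof.
  split.
  - intros; apply rt_refl.
  - exact esteps_Pi.
  - exact esteps_Lam.
  - exact esteps_App.
  (* The body is reduced first, under a fixed substitution; then the substituted term is reduced at
     all its occurrences. *)
  - intros M M' N N' HM HN. apply rt_trans with (einst N M').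
    + apply esteps_esubst; auto.
    + apply esteps_esubst_pointwise. intros [|n]; auto; apply rt_refl.
Qed.

End EptsReduction.

(** * Inverse translation and substitution *)

Section InverseSubstitution.

Variable Srt : Type.

(** Renamings are treated before substitutions because [dup] shifts the substituted terms under each
    binder. *)
Lemma invertible_dren (M : dk Srt) : invertible M ->
  forall r, invertible (dren r M).
Proof.
  intros H; induction H; intros r; simpl; constructor; auto.
Qed.

Lemma inverse_dren (M : dk Srt) : invertible M ->
  forall r, inverse (dren r M) = eren r (inverse M).
Proof.
  intros H; induction H; intros r; simpl; rewrite ?eren_einst; f_equal; auto.
Qed.

Lemma invertible_dup (f : nat -> dk Srt) :
  (forall n, invertible (f n)) -> forall n, invertible (dup f n).
Proof.
  intros Hf [|n]; simpl; [constructor | apply invertible_dren; auto].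
Qed.

Lemma invertible_dsubst (M : dk Srt) : invertible M ->
  forall f, (forall n, invertible (f n)) -> invertible (dsubst f M).
Proof.
  intros H; induction H; intros f Hf; simpl; auto; constructor;
    auto using invertible_dup.
Qed.

(** The redex case is [esubst_einst]; the cases with binders compare the two liftings through
    [inverse_dren]. The restriction to invertible forms excludes the dummy value [EVar 0], which is
    not stable under substitution. *)
Lemma inverse_dsubst (M : dk Srt) : invertible M ->
  forall f, (forall n, invertible (f n)) ->
  inverse (dsubst f M) = esubst (fun n => inverse (f n)) (inverse M).
Proof.
  assert (Hup : forall (f : nat -> dk Srt) (N : epts Srt),
    (forall n, invertible (f n)) ->
    esubst (eup (fun n => inverse (f n))) N
    = esubst (fun n => inverse (dup f n)) N)
    by (intros f N Hf; apply esubst_ext; intros [|n]; simpl;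
        rewrite ?inverse_dren; auto).
  intros H; induction H; intros f Hf; simpl;
    rewrite ?esubst_einst, ?Hup by assumption; f_equal;
    auto using invertible_dup.
Qed.

Lemma invertible_dsubst_var x (N M : dk Srt) :
  invertible M -> invertible N -> invertible (dsubst_var x N M).
Proof.
  intros HM HN. apply invertible_dsubst; auto.
  intros n; destruct (n =? x); auto; constructor.
Qed.

Lemma inverse_dsubst_var x (N M : dk Srt) :
  invertible M -> invertible N ->
  inverse (dsubst_var x N M) = esubst_var x (inverse N) (inverse M).
Proof.
  intros HM HN. unfold dsubst_var. rewrite inverse_dsubst; auto.
  - apply esubst_ext; intros n; destruct (n =? x); reflexivity.
  - intros n; destruct (n =? x); auto; constructor.
Qed.

Lemma invertible_dinst (N M : dk Srt) :
  invertible M -> invertible N -> invertible (dinst N M).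
Proof.
  intros HM HN. apply invertible_dsubst; auto.
  intros [|n]; auto; constructor.
Qed.

Lemma inverse_dinst (N M : dk Srt) :
  invertible M -> invertible N ->
  inverse (dinst N M) = einst (inverse N) (inverse M).
Proof.
  intros HM HN. unfold dinst. rewrite inverse_dsubst; auto.
  - apply esubst_ext; intros [|n]; reflexivity.
  - intros [|n]; auto; constructor.
Qed.

End InverseSubstitution.

(** * Inverse translation and reduction *)

Section InverseReduction.

Variable P : pts_spec.

Lemma beta_inverse (M N : dk P) :
  invertible M -> beta M N -> invertible N /\ inverse M = inverse N.
Proof.
  intros HM H; destruct H; inversion HM; subst.
  split; [apply invertible_dinst | symmetry; apply inverse_dinst]; auto.
Qed.

Lemma rule_El_not_invertible (M N : dk P) :
  rule_El P M N -> ~ invertible M.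
Proof. intros H HM; destruct H; inversion HM. Qed.

(** Inverting the [dabs] subterm shows that its body is an explicit abstraction. The reduct is
    therefore a Dedukti redex, again an invertible form, and [inverse] contracts it to exactly the
    EPTS contractum. *)
Lemma rule_app_inverse (M N : dk P) :
  invertible M -> rule_app P M N ->
  invertible N /\ estep (inverse M) (inverse N).
Proof.
  intros HM H; destruct H; inversion HM; subst.
  match goal with H : invertible (dabs _ _ _ _ _) |- _ =>
    inversion H; subst end.
  split; constructor; auto.
Qed.

(** No left-hand side is an abstraction, so the step is in the annotation or in the body. In the
    first case only [M' = M] is recorded, since [inverse] forgets the annotation. *)
Lemma ctx_Lam_inv (R : relation (dk P)) T M N :
  (forall X Y, R X Y -> dk_beta_R_EPTS P X Y) ->
  ctx R (Lam T M) N ->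
  exists T' M', N = Lam T' M' /\ (M' = M \/ ctx R M M').
Proof.
  intros HR H; inversion H; subst; eauto.
  match goal with H : R _ _ |- _ => apply HR in H end.
  unfold dk_beta_R_EPTS, dk_R_EPTS in *.
  repeat match goal with H : _ \/ _ |- _ => destruct H end;
    match goal with H : _ (Lam _ _) _ |- _ => inversion H end.
Qed.

(** Descends along the spine of an invertible form until the step is at a head or inside an
    invertible subterm. Abstractions go through [ctx_Lam_inv], which discards steps in
    annotations. *)
Ltac invert_step HR :=
  match goal with
  | H : ctx _ (Lam _ _) _ |- _ =>
      let T := fresh "T" in let X := fresh "X" in
      apply (ctx_Lam_inv HR) in H; destruct H as (T & X & -> & [->|H])
  | H : ctx _ (dabs _ _ _ _ _) _ |- _ => unfold dabs in H
  | H : ctx _ (dapp _ _ _ _ _ _) _ |- _ => unfold dapp in H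
  | H : ctx _ (dProd _ _ _ _) _ |- _ => unfold dProd in H
  | H : ctx _ (Const _) _ |- _ => inversion H; subst; clear H
  | H : ctx _ (App _ _) _ |- _ => inversion H; subst; clear H
  end.

(** One induction on invertible forms serves all reductions: [R] becomes each rule or their union,
    and [Q] becomes equality or [esteps]. *)
Lemma ctx_inverse (R : relation (dk P)) (Q : relation (epts P)) :
  (forall M N, R M N -> dk_beta_R_EPTS P M N) ->
  compatible Q ->
  (forall M N, invertible M -> R M N -> Q (inverse M) (inverse N)) ->
  forall M N, invertible M -> ctx R M N ->
  invertible N /\ Q (inverse M) (inverse N).
Proof.
  intros HR HQ Hhead.
  pose proof (compatible_refl HQ) as Hrefl.
  (* [Hhead] gives only the relation [Q]; invertibility of the reduct comes from a case analysis on
     the rule applied. *)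
  assert (Hroot : forall M N, invertible M -> R M N ->
    invertible N /\ Q (inverse M) (inverse N)).
  { intros M N HM H; split; auto.
    destruct (HR _ _ H) as [Hb | [He | Ha]].
    - eapply beta_inverse; eauto.
    - destruct (rule_El_not_invertible He HM).
    - eapply rule_app_inverse; eauto. }
  (* Proper prefixes of a spine are never left-hand sides of rules. *)
  assert (Hprefix : forall M N, R M N ->
    match M with
    | Var _ | Const _ | App (Const (cProd _ _)) _
    | App (App (Const (cabs _ _)) _) _ | App (Const (cabs _ _)) _
    | App (App (App (Const (capp _ _)) _) _) _
    | App (App (Const (capp _ _)) _) _ | App (Const (capp _ _)) _ => False
    | _ => True
    end).
  { intros M N H. destruct (HR _ _ H) as [Hb | [He | Ha]].
    - destruct Hb; exact I.
    - destruct He; exact I.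
    - destruct Ha; exact I. }
  intros M N HM; revert N.
  induction HM; intros N0 HN;
    repeat invert_step HR;
    try (inversion HN; subst);
    (* Steps at a variable, a constant or an incomplete spine are impossible by [Hprefix]; steps at
       the root of the whole form fall to [Hroot]. *)
    try match goal with H : R _ _ |- _ => destruct (Hprefix _ _ H) end;
    try match goal with H : R _ _ |- _ =>
      apply Hroot; [constructor; assumption | exact H] end;
    repeat match goal with
    | IH : (forall N, ctx R ?M N -> _), H : ctx R ?M _ |- _ =>
        apply IH in H; destruct H
    end;
    (* What is left is a step in one immediate subterm or in an annotation; [Hrefl] covers every
       component that [inverse] leaves unchanged. *)
    (split;
     [ constructor; assumption
     | simpl;
       first [ apply (compatible_Pi HQ) | apply (compatible_Lam HQ)
             | apply (compatible_App HQ) | apply (compatible_einst HQ) ];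
       auto ]).
Qed.

Lemma ctx_rule_app_inverse (M N : dk P) :
  invertible M -> ctx (rule_app P) M N ->
  invertible N /\ esteps (inverse M) (inverse N).
Proof.
  apply ctx_inverse; auto using compatible_esteps.
  - intros X Y H; right; right; exact H.
  - intros X Y HX H; apply rt_step. eapply rule_app_inverse; eauto.
Qed.

Lemma ctx_beta_inverse (M N : dk P) :
  invertible M -> ctx (@beta P) M N ->
  invertible N /\ inverse M = inverse N.
Proof.
  apply ctx_inverse; auto using compatible_eq.
  - intros X Y H; left; exact H.
  - intros X Y HX H; eapply beta_inverse; eauto.
Qed.

Lemma ctx_rule_El_inverse (M N : dk P) :
  invertible M -> ctx (rule_El P) M N ->
  invertible N /\ inverse M = inverse N.
Proof.
  apply ctx_inverse; auto using compatible_eq.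
  - intros X Y H; right; left; exact H.
  - intros X Y HX H; destruct (rule_El_not_invertible H HX).
Qed.

Lemma ctx_dk_beta_R_EPTS_inverse (M N : dk P) :
  invertible M -> ctx (dk_beta_R_EPTS P) M N ->
  invertible N /\ esteps (inverse M) (inverse N).
Proof.
  apply ctx_inverse; auto using compatible_esteps.
  intros X Y HX [Hb | [He | Ha]].
  - destruct (beta_inverse HX Hb) as [_ ->]; apply rt_refl.
  - destruct (rule_El_not_invertible He HX).
  - apply rt_step. eapply rule_app_inverse; eauto.
Qed.

(** Invertibility of [M] comes after the reduction so that the induction hypotheses keep it as a
    premise: the first half of a chain then supplies it for the intermediate term. *)
Lemma dk_reduction_inverse (M N : dk P) :
  clos_refl_trans (dk P) (ctx (dk_beta_R_EPTS P)) M N ->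
  invertible M -> invertible N /\ esteps (inverse M) (inverse N).
Proof.
  intros H; induction H as [| |M N O _ IH1 _ IH2]; intros HM.
  - apply ctx_dk_beta_R_EPTS_inverse; auto.
  - split; auto; apply rt_refl.
  - destruct (IH1 HM) as [HN H1]. destruct (IH2 HN) as [HO H2].
    split; auto; eapply rt_trans; eauto.
Qed.

End InverseReduction.

Theorem mainTheorem13 (P : pts_spec) (HP : functional P)
    (M : dk P) (HM : invertible M) :
  (forall N : dk P, invertible N ->
     (forall x : nat,
        invertible (dsubst_var x N M) /\
        esubst_var x (inverse N) (inverse M) = inverse (dsubst_var x N M)) /\
     (invertible (dinst N M) /\
      einst (inverse N) (inverse M) = inverse (dinst N M))) /\
  (forall N : dk P, ctx (rule_app P) M N ->
     invertible N /\ esteps (inverse M) (inverse N)) /\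
  (forall N : dk P, ctx (@beta P) M N \/ ctx (rule_El P) M N ->
     invertible N /\ inverse M = inverse N) /\
  (forall N : dk P, clos_refl_trans (dk P) (ctx (dk_beta_R_EPTS P)) M N ->
     invertible N /\ esteps (inverse M) (inverse N)).
Proof.
  split; [| split; [| split]].
  - intros N HN. split; [intros x |]; split.
    + apply invertible_dsubst_var; auto.
    + symmetry; apply inverse_dsubst_var; auto.
    + apply invertible_dinst; auto.
    + symmetry; apply inverse_dinst; auto.
  - intros N H; apply ctx_rule_app_inverse; auto.
  - intros N [H | H]; [apply ctx_beta_inverse | apply ctx_rule_El_inverse]; auto.
  - intros N H; apply dk_reduction_inverse; auto.
Qed.
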